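(* Let $\mathbb R^\flat$ be the real tropical hyperfield. (i) $\mathbb R^\flat$ is perfect and of characteristic one. (ii) The map $\lambda\mapsto\theta_\lambda$, where $\theta_\lambda(x)=\mathrm{sign}(x)|x|^\lambda$ for all $x\in\mathbb R$, defines a group isomorphism $\theta:\mathbb R_+^\times\to\mathrm{Aut}(\mathbb R^\flat)$. If $\lambda=\frac ab\in\mathbb Q_+^\times$ is odd (i.e. both $a$ and $b$ are odd integers) one has $\theta_\lambda(x)=x^\lambda$ for all $x\in\mathbb R$. (iii) The compact subset $[-1,1]\subset\mathbb R^\flat$ is the maximal compact sub-hyperring $\mathcal O$ of $\mathbb R^\flat$. (iv) The hyperfield $\mathbb R^\flat$ is complete for the distance $d(x,y)=|x-y|$ (the usual distance of the underlying real numbers).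
   Context: A hyperfield is a set $H$ with distinct elements $0,1$, a commutative associative multiplication for which $H\setminus\{0\}$ is an abelian group with unit $1$ and $0\cdot x=0$, and a multivalued addition $(x,y)\mapsto x+y$ with values non-empty subsets of $H$, which is commutative, associative ($(x+y)+z=x+(y+z)$, where $A+B=\bigcup_{a\in A,b\in B}(a+b)$), satisfies $x+0=\{x\}$, has for each $x$ a unique $-x$ with $0\in x+(-x)$, satisfies $x\in y+z\Rightarrow z\in x+(-y)$, and is distributive. An automorphism of $H$ is a bijective multiplicative map $f:H\to H$ with $f(x+y)=f(x)+f(y)$ for all $x,y$; $\mathrm{Aut}(H)$ is the group of automorphisms. A sub-hyperring is a subset containing $0$ and $1$, stable under $x\mapsto -x$, multiplication and hyperaddition (i.e. $x+y$ is contained in the subset for $x,y$ in the subset). The real tropical hyperfield $\mathbb R^\flat$ is the set $\mathbb R$ (with its usual topology) with its usual multiplication and the hyperaddition $x\smile y=x$ if $|x|>|y|$ or $x=y$; $x\smile y=y$ if $|x|<|y|$; $x\smile y=[-|x|,|x|]$ if $y=-x$. A hyperfield $H$ is of characteristic one if $x+x=x$ for all $x\in H$. A hyperfield $H$ of characteristic one is perfect if for any odd integer $n>0$ the map $x\mapsto x^n$ is an automorphism of $H$. $\mathbb R_+^\times$ is the multiplicative group of positive real numbers. *)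

(* Defs.v *)
From HB Require Import structures.
From mathcomp Require Import all_boot all_order all_algebra.
From mathcomp Require Import all_classical all_reals all_analysis.
From mathcomp Require Import lra.
Import Order.TTheory GRing.Theory Num.Theory.
Import numFieldNormedType.Exports.

Set Implicit Arguments.
Unset Strict Implicit.
Unset Printing Implicit Defensive.

Local Open Scope classical_set_scope.

(* The multiplicative monoid of H is written with the notations of group_scope
   (1, x * y, x ^+ n).  Since the product is commutative, one-sided forms of
   the axioms suffice. *)
HB.mixin Record Monoid_isHyperfield H of Monoid H := {
  hzero : H;
  hopp : H -> H;
  hadd : H -> H -> set H;
  hmulC : forall x y : H, (x * y = y * x)%g;
  hone_neq0 : (1%g : H) <> hzero;
  hmul0 : forall x : H, (hzero * x)%g = hzero;
  hmul_neq0 : forall x y : H, x <> hzero -> y <> hzero -> (x * y)%g <> hzero;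
  hmulV : forall x : H, x <> hzero -> exists2 y : H, y <> hzero & (x * y = 1)%g;
  hadd_nonempty : forall x y, hadd x y !=set0;
  haddC : forall x y, hadd x y = hadd y x;
  haddA : forall x y z,
    \bigcup_(a in hadd x y) hadd a z = \bigcup_(b in hadd y z) hadd x b;
  hadd0 : forall x, hadd x hzero = [set x];
  haddN : forall x, hadd x (hopp x) hzero;
  hopp_uniq : forall x y, hadd x y hzero -> y = hopp x;
  hadd_reversible : forall x y z, hadd y z x -> hadd x (hopp y) z;
  hmulDr : forall x y z : H,
    [set (x * a)%g | a in hadd y z] = hadd (x * y)%g (x * z)%g
}.

#[short(type="hyperfieldType")]
HB.structure Definition Hyperfield := {H of Monoid_isHyperfield H & Monoid H}.

Definition characteristic_one (H : hyperfieldType) : Prop :=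
  forall x : H, hadd x x = [set x].

Definition is_hyperautomorphism (H : hyperfieldType) (f : H -> H) : Prop :=
  [/\ bijective f,
      forall x y, f (x * y)%g = (f x * f y)%g
    & forall x y, [set f z | z in hadd x y] = hadd (f x) (f y)].

Definition perfect (H : hyperfieldType) : Prop :=
  forall n : nat, odd n -> is_hyperautomorphism (fun x : H => (x ^+ n)%g).

Definition is_subhyperring (H : hyperfieldType) (A : set H) : Prop :=
  [/\ A hzero /\ A 1%g,
      forall x, A x -> A (hopp x),
      forall x y, A x -> A y -> A (x * y)%g
    & forall x y, A x -> A y -> hadd x y `<=` A].

Record Aut (H : hyperfieldType) := MkAut {
  aut_fun :> H -> H;
  autP : is_hyperautomorphism aut_fun
}.

HB.instance Definition _ (H : hyperfieldType) := gen_eqMixin (Aut H).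
HB.instance Definition _ (H : hyperfieldType) := gen_choiceMixin (Aut H).

Section AutGroup.
Variable H : hyperfieldType.
Implicit Types f g h : Aut H.

Lemma aut_inj f g : f =1 g -> f = g.
Proof.
case: f g => [f Pf] [g Pg] /= /funext fg; case: g / fg Pg => Pg.
by congr MkAut; exact: Prop_irrelevance.
Qed.

Lemma aut_id_proof : is_hyperautomorphism (@id H).
Proof. by split=> // [|x y]; [exists id | rewrite image_id]. Qed.

Lemma aut_comp_proof f g : is_hyperautomorphism (f \o g).
Proof.
case: (autP f) (autP g) => [fb fM fD] [gb gM gD]; split=> [|x y|x y].
- exact: bij_comp.
- by rewrite /= gM fM.
- by rewrite -fD -gD image_comp.
Qed.

Lemma aut_inv_exists f : exists g : Aut H, cancel f g /\ cancel g f.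
Proof.
case: (autP f) => [[g fK gK] fM fD].
suff gP : is_hyperautomorphism g by exists (MkAut gP).
split=> [|x y|x y]; first by exists f.
- by rewrite -{1}[x]gK -{1}[y]gK -fM fK.
- rewrite -{1}[x]gK -{1}[y]gK -fD image_comp.
  by rewrite (_ : g \o f = id) ?image_id//; apply/funext.
Qed.

Definition aut_one : Aut H := MkAut aut_id_proof.
Definition aut_mul f g : Aut H := MkAut (aut_comp_proof f g).
Definition aut_inv f : Aut H := sval (cid (aut_inv_exists f)).

Lemma aut_mulA : associative aut_mul.
Proof. by move=> f g h; apply: aut_inj. Qed.

Lemma aut_mul1 : left_id aut_one aut_mul.
Proof. by move=> f; apply: aut_inj. Qed.

Lemma aut_1mul : right_id aut_one aut_mul.
Proof. by move=> f; apply: aut_inj. Qed.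

Lemma aut_mulV : left_inverse aut_one aut_inv aut_mul.
Proof.
move=> f; apply: aut_inj => x /=.
by rewrite /aut_inv; case: cid => g /= [fK _]; exact: fK.
Qed.

Lemma aut_mulrV : right_inverse aut_one aut_inv aut_mul.
Proof.
move=> f; apply: aut_inj => x /=.
by rewrite /aut_inv; case: cid => g /= [_ gK]; exact: gK.
Qed.

HB.instance Definition _ :=
  isGroup.Build (Aut H) aut_mulA aut_mul1 aut_1mul aut_mulV aut_mulrV.

End AutGroup.

Local Open Scope ring_scope.

Definition posreals (R : realType) : Type := {posnum R}.
HB.instance Definition _ (R : realType) := Choice.on (posreals R).

Section PosrealsGroup.
Variable R : realType.
Implicit Types x y z : posreals R.

Definition posreals_one : posreals R := 1%:pos.
Definition posreals_mul x y : posreals R := (x%:num * y%:num)%:pos.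
Definition posreals_inv x : posreals R := (x%:num^-1)%:pos.

Lemma posreals_mulA : associative posreals_mul.
Proof. by move=> x y z; apply: val_inj; rewrite /= mulrA. Qed.

Lemma posreals_mul1 : left_id posreals_one posreals_mul.
Proof. by move=> x; apply: val_inj; rewrite /= mul1r. Qed.

Lemma posreals_1mul : right_id posreals_one posreals_mul.
Proof. by move=> x; apply: val_inj; rewrite /= mulr1. Qed.

Lemma posreals_mulV : left_inverse posreals_one posreals_inv posreals_mul.
Proof. by move=> x; apply: val_inj; rewrite /= mulVf. Qed.

Lemma posreals_mulrV : right_inverse posreals_one posreals_inv posreals_mul.
Proof. by move=> x; apply: val_inj; rewrite /= mulfV. Qed.

HB.instance Definition _ := isGroup.Build (posreals R)
  posreals_mulA posreals_mul1 posreals_1mul posreals_mulV posreals_mulrV.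

End PosrealsGroup.

(* A copy of R with its usual topology and uniform structure, which carries
   the hyperaddition below instead of the addition. *)
Definition Rflat (R : realType) : Type := R.
HB.instance Definition _ (R : realType) := Choice.on (Rflat R).
HB.instance Definition _ (R : realType) := PseudoMetric.copy (Rflat R) R^o.

Section RflatMetric.
Variable R : realType.

Definition Rflat_dist (x y : Rflat R) : R := `|(x : R) - (y : R)|.

Lemma Rflat_dist_ge0 x y : 0 <= Rflat_dist x y.
Proof. exact: normr_ge0. Qed.

Lemma Rflat_dist_positivity x y : Rflat_dist x y = 0 -> x = y.
Proof. by move/eqP; rewrite normr_eq0 subr_eq0 => /eqP. Qed.

Lemma Rflat_ballE (x : Rflat R) (d : R) :
  ball x d = [set y | Rflat_dist x y < d].
Proof. by []. Qed.

HB.instance Definition _ := PseudoMetric_isMetric.Build R (Rflat R)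
  Rflat_dist_ge0 Rflat_dist_positivity Rflat_ballE.

End RflatMetric.

(* If |x| = |y| and x <> y then y = - x. *)
Definition smile (R : realType) (x y : R) : set R :=
  if (`|y| < `|x|) || (x == y) then [set x]
  else if `|x| < `|y| then [set y]
  else [set` `[- `|x|, `|x|]].

Section RflatHyperfield.
Variable R : realType.
Implicit Types x y z w : R.

HB.instance Definition _ := isMonoid.Build (Rflat R)
  (@mulrA R) (@mul1r R) (@mulr1 R).

Let normE x : (0 <= x /\ `|x| = x) \/ (x < 0 /\ `|x| = - x).
Proof. by case: (ger0P x) => h; [left|right]. Qed.

Lemma smileP x y w : smile x y w <->
  (w = x /\ (`|y| < `|x| \/ x = y)) \/ (w = y /\ `|x| < `|y|) \/
  (y = - x /\ `|w| <= `|x|).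
Proof.
have := normE x; have := normE y; have := normE w.
rewrite /smile; have [yx|xy|exy] := ltgtP `|y| `|x| => /=; last first.
  have [e|ne] := eqVneq x y => /=; first by rewrite e in exy *; split; lra.
  by rewrite in_itv /=; move/eqP: ne => ne; split; lra.
all: have [e|ne] := eqVneq x y => /=.
all: by split; lra.
Qed.

Lemma smile_nonempty x y : smile x y !=set0.
Proof.
rewrite /smile; case: ifP => _; first by exists x.
case: ifP => _; first by exists y.
by exists 0; rewrite /= in_itv /= oppr_le0 normr_ge0.
Qed.

Lemma smileC x y : smile x y = smile y x.
Proof.
have := normE x; have := normE y => ? ?.
by apply/seteqP; split=> w /smileP ?; apply/smileP; have := normE w; lra.
Qed.

Let smile_lt x y w : `|x| < `|y| -> smile x y w <-> w = y.
Proof.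
have := normE x; have := normE y; rewrite smileP => ? ? ?; split; lra.
Qed.

Let smile_gt x y w : `|y| < `|x| -> smile x y w <-> w = x.
Proof. by rewrite smileC; exact: smile_lt. Qed.

Let smilexx x w : smile x x w <-> w = x.
Proof.
by have := normE x; have := normE w; rewrite smileP => ? ?; split; lra.
Qed.

Let smilexN x w : smile x (- x) w <-> `|w| <= `|x|.
Proof.
have := normE x; have := normE w; rewrite smileP normrN => ? ?; split; lra.
Qed.

Let smile_norm x y w : smile x y w -> `|w| <= Num.max `|x| `|y|.
Proof.
rewrite smileP le_max.
by move=> [[-> _]|[[-> _]|[_ ->]]]; rewrite ?lexx ?orbT.
Qed.

Let smileA_sub x y z :
  \bigcup_(a in smile x y) smile a z `<=` \bigcup_(b in smile y z) smile x b.
Proof.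
move=> w [a xya azw]; have := smile_norm xya; have := smile_norm azw.
rewrite !le_max => wn an.
have [yz|zy|eyz] := ltgtP `|y| `|z|.
- exists z; first exact/smile_lt.
  have [xz|zx] := ltP `|x| `|z|.
    move: azw; rewrite (smile_lt _ xz) smile_lt//.
    by case/orP: an => an; exact: le_lt_trans an _.
  by move: xya azw; rewrite smile_gt ?(lt_le_trans yz)// => ->.
- exists y; first exact/smile_gt.
  move: (xya) => /smileP[[ax h]|[[ay xy]|[ey ax]]].
  + move: azw; rewrite smile_gt; first by move=> ->.
    by rewrite ax; case: h => [|->//]; exact: lt_trans.
  + by move: azw; rewrite smile_gt ay // => ->; exact/smile_lt.
  + move: zy wn; rewrite ey normrN smilexN => zx /orP[|] h.
      exact: le_trans h ax.
    exact: le_trans h (ltW zx).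
have /orP[/eqP ezy|/eqP ezy] : (y == z) || (y == - z) by rewrite -eqr_norm2 eyz.
- rewrite -{}ezy in azw wn *; exists y; first exact/smilexx.
  move: xya => /smileP[[ax _]|[[ay xy]|[ey ax]]].
  + by rewrite -ax.
  + by move: azw; rewrite ay => /smilexx ->; exact/smile_lt.
  + by move: wn; rewrite ey normrN smilexN => /orP[h|//]; exact: le_trans h ax.
have {}ezy : z = - y by rewrite ezy opprK.
rewrite {}ezy normrN in azw wn *.
have [yx|xy] := ltP `|y| `|x|.
  exists y; first by rewrite smilexN.
  move: xya azw; rewrite smile_gt// => ->.
  by rewrite !smile_gt// normrN.
have ay : `|a| <= `|y| by case/orP: an => // h; exact: le_trans h xy.
have wy : `|w| <= `|y| by case/orP: wn => // h; exact: le_trans h ay.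
have [xw|wx] := ltP `|x| `|w|.
  by exists w; [rewrite smilexN | rewrite smile_lt].
by exists (- x); rewrite smilexN ?normrN.
Qed.

Lemma smileA x y z :
  \bigcup_(a in smile x y) smile a z = \bigcup_(b in smile y z) smile x b.
Proof.
apply/seteqP; split; first exact: smileA_sub.
move=> w [b yzb xbw].
have [|a] := @smileA_sub z y x w; first by exists b; rewrite smileC.
by move=> ? ?; exists a; rewrite smileC.
Qed.

Lemma smile0 x : smile x 0 = [set x].
Proof.
have := normE x; have := normr0 R => ? ?.
apply/seteqP; split=> w /=; have := normE w => ?.
  by move=> /smileP; lra.
by move=> ->; apply/smileP; lra.
Qed.

Lemma smileN x : smile x (- x) 0.
Proof. by apply/smileP; right; right; rewrite normr0 normr_ge0. Qed.

Lemma smile_opp_uniq x y : smile x y 0 -> y = - x.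
Proof.
have := normE x; have := normE y; have := normr0 R => ? ? ?.
by move=> /smileP; lra.
Qed.

Lemma smile_reversible x y z : smile y z x -> smile x (- y) z.
Proof.
have := normE x; have := normE y; have := normE z => ? ? ?.
by move=> /smileP ?; apply/smileP; rewrite normrN; lra.
Qed.

Lemma smileMr x y z : [set x * a | a in smile y z] = smile (x * y) (x * z).
Proof.
have [->|x0] := eqVneq x 0.
  rewrite !mul0r smile0; apply/seteqP; split=> w /=.
    by move=> [a _ <-]; rewrite mul0r.
  by have [a yza] := smile_nonempty y z => ->; exists a; rewrite ?mul0r.
have nx0 : 0 < `|x| by rewrite normr_gt0.
have E a : smile (x * y) (x * z) (x * a) <-> smile y z a.
  rewrite !smileP !normrM -mulrN !ltr_pM2l// ler_pM2l//.
  have I := mulfI x0.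
  by split=> [[[/I ? [?|/I ?]]|[[/I]|[/I]]]|[[-> [?|->]]|[[-> ?]|[-> ?]]]]; 
    intuition.
apply/seteqP; split=> w /=; first by move=> [a ya <-]; apply/E.
have {1}-> : w = x * (x^-1 * w) by rewrite mulVKf.
by move/E => h; exists (x^-1 * w) => //; rewrite mulVKf.
Qed.

Let one_neq0 : (1 : R) <> 0.
Proof. by apply/eqP; exact: oner_neq0. Qed.

Let mulV x : x <> 0 -> exists2 y : R, y <> 0 & x * y = 1.
Proof.
move=> /eqP x0; exists x^-1; last exact: mulfV.
by apply/eqP; rewrite invr_eq0.
Qed.

Let mul_neq0 x y : x <> 0 -> y <> 0 -> x * y <> 0.
Proof. by move=> /eqP x0 /eqP y0; apply/eqP; rewrite mulf_neq0. Qed.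

HB.instance Definition _ := Monoid_isHyperfield.Build (Rflat R)
  (@mulrC R) one_neq0 (@mul0r R) mul_neq0 mulV smile_nonempty smileC smileA
  smile0 smileN smile_opp_uniq smile_reversible smileMr.

End RflatHyperfield.

Definition theta_fun (R : realType) (l : posreals R) (x : R) : R :=
  Num.sg x * `|x| `^ l%:num.

(* y = x ^ (a / b) for b odd: the b-th root of x ^ a, x being possibly
   negative *)
Definition is_odd_power (R : realType) (a b : nat) (x y : R) : Prop :=
  unique (fun t : R => t ^+ b = x ^+ a) y.

(* Main.v *)
From HB Require Import structures.
Require Import Defs.
From mathcomp Require Import all_boot all_order all_algebra.
From mathcomp Require Import all_classical all_reals all_analysis.
From mathcomp Require Import lra.
Import Order.TTheory GRing.Theory Num.Theory.
Import numFieldNormedType.Exports.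

Local Open Scope classical_set_scope.
Local Open Scope ring_scope.

(** The hyperaddition of [R^flat] is determined by the comparison of absolute
    values, by equality and by the sign change.  Hence any odd bijection of the
    line that is strictly increasing in absolute value preserves it
    ([image_smile]); the maps [theta_l] are of this kind and are moreover
    multiplicative, so they are automorphisms.  For an odd natural number [n]
    the map [x |-> x ^+ n] is [theta_n], which gives perfection, and
    [theta_(a / b) x] is the [b]-th root of [x ^+ a] because
    [theta_b \o theta_(a / b) = theta_a].

    Conversely, an automorphism [f] fixes [0], commutes with the sign change
    (as [- x] is the only [y] with [0] in [x + y]), and is increasing in
    absolute value, since [|x| <= |y|] says exactly that [x] belongs to
    [y + (- y)].  A positive number is a square, so [f] preserves positivity,
    and [t |-> ln (f (expR t))] is a monotone additive map of the line, hence
    a homothety by Cauchy's functional equation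
    ([additive_nondecreasing_linear]).  Its ratio [l] satisfies
    [f x = x `^ l] for [x > 0], and oddness extends this to [f = theta_l].

    A compact sub-hyperring contains an element [c] of maximal absolute value;
    as it also contains [c ^+ 2], that maximum is at most [1].  Completeness is
    that of the real line, since the uniform structure is the usual one. *)

(** * Cauchy's functional equation *)

(** The defect [g t - t * g 1] is additive and vanishes on the integers, so by
    monotonicity on the unit interval it is bounded on the whole line by [g 1];
    an additive map that is bounded on the line is zero. *)
Lemma additive_nondecreasing_linear (R : realType) (g : {additive R -> R}) :
  {homo g : x y / x <= y} -> forall t, g t = t * g 1.
Proof.
move=> g_le t.
have gz (m : int) : g m%:~R = m%:~R * g 1 by rewrite raddfMz mulrzl.
have defect s : `|g s - s * g 1| <= g 1.
  (* Subtracting the integral part of [s] does not change the defect. *)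
  have /andP[ms sm] := floor_itv s; set m := Num.floor s in ms sm *.
  rewrite intrD1 in sm.
  have -> : g s - s * g 1 = g (s - m%:~R) - (s - m%:~R) * g 1.
    by rewrite raddfB gz mulrBl opprB addrA subrK.
  have u0 : 0 <= s - m%:~R by rewrite subr_ge0.
  have u1 : s - m%:~R <= 1 by rewrite lerBlDl ltW.
  have := g_le _ _ u0; have := g_le _ _ u1; rewrite raddf0.
  move: (s - _) u0 u1 => u u0 u1 gu1 gu0.
  have := mulr_ge0 u0 (le_trans gu0 gu1).
  have := ler_wpM2r (le_trans gu0 gu1) u1.
  by rewrite ler_norml; lra.
apply/eqP; rewrite -subr_eq0 -normr_le0 leNgt; apply/negP.
set d := `|_| => d0.
have := truncnS_gt (g 1 / d); set n := (Num.trunc _).+1.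
rewrite ltr_pdivrMr// => /(le_lt_trans (defect (t *+ n))).
rewrite raddfMn mulrnAl -mulrnBl normrMn -/d.
by rewrite mulr_natl ltxx.
Qed.

(** * The signed powers *)

(** Every clause of [smileP] is an equality, a sign change or a comparison of
    absolute values, and such an [f] reflects all three; surjectivity then turns
    the equivalence on points into an equality of images. *)
Lemma image_smile (R : realType) (f : R -> R) :
  bijective f -> {morph f : x / - x} ->
  (forall x y, (`|f x| < `|f y|) = (`|x| < `|y|)) ->
  forall x y, [set f z | z in smile x y] = smile (f x) (f y).
Proof.
move=> fbij fN fnorm x y.
have f_inj u v : (f u = f v) <-> (u = v).
  by split=> [|->//]; exact: (bij_inj fbij).
have E w : smile (f x) (f y) (f w) <-> smile x y w.
  by rewrite !smileP -fN !f_inj !leNgt !fnorm.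
have [f' _ f'K] := fbij.
apply/seteqP; split=> w /=; first by move=> [a xya <-]; apply/E.
by rewrite -{1}(f'K w) => /E ?; exists (f' w).
Qed.

Lemma sgr_theta (R : realType) (l : posreals R) x :
  Num.sg (theta_fun l x) = Num.sg x.
Proof.
rewrite /theta_fun sgrM sgr_id; have [->|x0] := eqVneq x 0.
  by rewrite sgr0 mul0r.
by rewrite [X in _ * X]gtr0_sg ?mulr1// powR_gt0// normr_gt0.
Qed.

Lemma normr_theta (R : realType) (l : posreals R) x :
  `|theta_fun l x| = `|x| `^ l%:num.
Proof.
rewrite /theta_fun normrM normr_sg (ger0_norm (powR_ge0 _ _)).
by have [->|x0] := eqVneq x 0; rewrite ?mul1r// normr0 powR0 ?mul0r.
Qed.

Lemma thetaM (R : realType) (l : posreals R) :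
  {morph theta_fun l : x y / x * y}.
Proof. by move=> x y; rewrite /theta_fun sgrM normrM powRM// mulrACA. Qed.

Lemma thetaN (R : realType) (l : posreals R) : {morph theta_fun l : x / - x}.
Proof. by move=> x; rewrite /theta_fun sgrN normrN mulNr. Qed.

Lemma theta_theta (R : realType) (l m : posreals R) x :
  theta_fun l (theta_fun m x) = theta_fun (l * m)%g x.
Proof.
by rewrite {1}/theta_fun sgr_theta normr_theta -powRrM [m%:num * _]mulrC.
Qed.

Lemma theta1 (R : realType) x : theta_fun (1%g : posreals R) x = x.
Proof. by rewrite /theta_fun powRr1// mulr_sg_norm. Qed.

Lemma theta_bij (R : realType) (l : posreals R) : bijective (theta_fun l).
Proof.
by exists (theta_fun l^-1%g) => x; rewrite theta_theta ?mulVg ?mulgV theta1.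
Qed.

Lemma theta_aut (R : realType) (l : posreals R) :
  @is_hyperautomorphism (Rflat R) (theta_fun l).
Proof.
split; [exact: theta_bij | exact: thetaM | apply: image_smile].
- exact: theta_bij.
- exact: thetaN.
- move=> x y; rewrite !normr_theta; apply/idP/idP.
    by rewrite !ltNge; apply: contra => /ge0_ler_powR; apply; rewrite ?nnegrE.
  by move/gt0_ltr_powR; apply; rewrite ?nnegrE.
Qed.

Lemma theta_odd (R : realType) (n : nat) (l : posreals R) x :
  odd n -> l%:num = n%:R -> theta_fun l x = x ^+ n.
Proof.
move=> n_odd ln; rewrite /theta_fun ln powR_mulrn//.
have [->|x0] := eqVneq x 0.
  by rewrite sgr0 mul0r expr0n; case: n n_odd {ln}.
by rewrite {3}(numEsg x) exprMn sgr_odd// n_odd.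
Qed.

Lemma odd_posreals (R : realType) (n : nat) :
  odd n -> exists l : posreals R, l%:num = n%:R.
Proof.
move=> n_odd; have n0 : 0 < n%:R :> R by rewrite ltr0n; case: n n_odd.
by exists (PosNum n0).
Qed.

(** Raising to the odd power [b] is [theta_b]: the composition law shows that
    [theta_(a / b) x] is a [b]-th root of [x ^+ a], and injectivity of [theta_b]
    that there is no other. *)
Lemma theta_odd_power (R : realType) (a b : nat) (l : posreals R) x :
  odd a -> odd b -> l%:num = a%:R / b%:R -> is_odd_power a b x (theta_fun l x).
Proof.
move=> a_odd b_odd lab; have [lb lbE] := odd_posreals R b b_odd.
have b0 : b%:R != 0 :> R by rewrite -lbE.
have thE : theta_fun l x ^+ b = x ^+ a.
  rewrite -(theta_odd _ _ lb)// theta_theta (theta_odd _ a)//.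
  by rewrite [LHS](_ : _ = lb%:num * l%:num)// lbE lab mulrCA mulfV ?mulr1.
split=> // t; rewrite -thE -!(theta_odd _ _ lb)// => /esym.
exact: (bij_inj (theta_bij _ lb)).
Qed.

Lemma theta_inj (R : realType) (l m : posreals R) :
  theta_fun l =1 theta_fun m -> l = m.
Proof.
move=> /(_ (expR 1)); rewrite /theta_fun gtr0_sg ?expR_gt0// !mul1r.
rewrite (gtr0_norm (expR_gt0 _)) -!expRM !mul1r => /expR_inj lm.
exact: val_inj.
Qed.

(** * Automorphisms are signed powers *)

(** Conjugation by [expR] and [ln] turns the restriction of [f] to the positive
    numbers into a monotone additive map, whose ratio is the exponent. *)
Lemma aut_theta (R : realType) (f : Aut (Rflat R)) :
  exists l : posreals R, forall x : R, f x = theta_fun l x.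
Proof.
case: f => f [fbij fM fD] /=.
pose F : R -> R := f; rewrite -/F.
have {}fbij : bijective F by [].
have {}fM : {morph F : x y / x * y} by exact: fM.
have {}fD x y z : smile x y z -> smile (F x) (F y) (F z).
  move=> xyz; have E : [set F z | z in smile x y] = smile (F x) (F y) := fD x y.
  by rewrite -E; exists z.
move: F fbij fM fD => {f} f fbij fM fD.
have f_inj := bij_inj fbij.
have f0 : f 0 = 0.
  by have [g _ gK] := fbij; have := fM 0 (g 0); rewrite mul0r gK mulr0.
have f_neq0 x : x != 0 -> f x != 0 by rewrite -{2}f0 (inj_eq f_inj).
have f1 : f 1 = 1.
  by apply: (mulfI (f_neq0 _ (oner_neq0 R))); rewrite -fM !mulr1.
have fN x : f (- x) = - f x.
  by have := fD _ _ _ (smileN x); rewrite f0; exact: smile_opp_uniq.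
have f_norm x y : `|x| <= `|y| -> `|f x| <= `|f y|.
  move=> xy; have : smile (f y) (f (- y)) (f x).
    (* The last clause of [smileP]: [y + (- y)] is the ball of radius [|y|]. *)
    by apply/fD/smileP; right; right.
  by rewrite fN => /smileP[[-> _]|[[-> _]|[_ ?]]]; rewrite ?normrN.
(* A positive number is the square of a nonzero one. *)
have f_gt0 x : 0 < x -> 0 < f x.
  move=> x0; rewrite -(sqr_sqrtr (ltW x0)) expr2 fM -expr2 exprn_even_gt0//=.
  by rewrite f_neq0// sqrtr_eq0 -ltNge.
pose g t := ln (f (expR t)).
have gE t : f (expR t) = expR (g t) by rewrite lnK// posrE f_gt0 ?expR_gt0.
have g_add : zmod_morphism g.
  move=> x y; apply/expR_inj; rewrite expRD expRN -!gE.
  have fy0 : f (expR y) != 0 by rewrite gt_eqF// f_gt0// expR_gt0.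
  by apply: (mulIf fy0); rewrite -fM -expRD subrK mulfVK.
pose gZ := GRing.isZmodMorphism.Build R R g g_add.
pose ga : {additive R -> R} := HB.pack g gZ.
have g_le : {homo ga : x y / x <= y}.
  move=> x y xy; rewrite -ler_expR /= -!gE.
  have := f_norm (expR x) (expR y).
  by rewrite !gtr0_norm ?f_gt0 ?expR_gt0// ler_expR; apply.
have l0 : 0 < g 1.
  rewrite lt_neqAle (_ : 0 = g 0) ?(g_le 0 1 ler01) ?andbT; last first.
    by rewrite /g expR0 f1 ln1.
  apply/negP => /eqP /(congr1 (@expR R)); rewrite -!gE => /f_inj /expR_inj /eqP.
  by rewrite eq_sym oner_eq0.
have gl t : g t = t * g 1 := additive_nondecreasing_linear R ga g_le t.
pose l : posreals R := PosNum l0; exists l.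
have f_pos x : 0 < x -> f x = theta_fun l x.
  move=> x0; rewrite -{1}(lnK x0) gE gl.
  by rewrite expRM lnK// /theta_fun gtr0_sg// gtr0_norm// mul1r.
move=> x; have [x0|x0|->] := ltgtP x 0; last by rewrite f0 /theta_fun sgr0 mul0r.
- by rewrite -[x]opprK fN thetaN f_pos// oppr_gt0.
- exact: f_pos.
Qed.

(** * Compact sub-hyperrings *)

Lemma compact_subhyperring_le1 (R : realType) (A : set (Rflat R)) :
  compact A -> is_subhyperring A -> forall x : R, A x -> `|x| <= 1.
Proof.
move=> Ac [[_ A1] _ AM _] x Ax.
have A0 : A !=set0 by exists (1%g : Rflat R).
have nc : {within A, continuous (fun y : Rflat R => `|y : R|)}.
  by apply: continuous_subspaceT; exact: (@norm_continuous R R^o).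
have [c cA cmax] := compact_EVT_max A0 Ac nc.
apply: le_trans (cmax x (mem_set Ax)) _.
have := cmax _ (mem_set (AM _ _ (set_mem cA) (set_mem cA))).
rewrite normrM leNgt => /negP cc; rewrite leNgt; apply/negP => c1.
by apply: cc; rewrite ltr_pMr// (lt_trans ltr01).
Qed.

Lemma unit_ball_subhyperring (R : realType) :
  @is_subhyperring (Rflat R) [set x : R | `|x| <= 1].
Proof.
split=> [|x|x y|x y] /=.
- by rewrite normr0 normr1 ler01 lexx.
- by rewrite normrN.
- by move=> x1 y1; rewrite normrM mulr_ile1.
- move=> x1 y1 w /smileP[[-> _]//|[[-> _]//|[_ wx]]]; exact: le_trans wx x1.
Qed.

Theorem proposition2p4 (R : realType) :
  (* (i) *)
  (characteristic_one (Rflat R) /\ perfect (Rflat R)) /\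
  (* (ii) *)
  (exists theta : {multiplicative posreals R -> Aut (Rflat R)},
     [/\ bijective theta,
         forall (l : posreals R) (x : Rflat R), theta l x = theta_fun l x
       & forall (a b : nat) (l : posreals R),
           odd a -> odd b -> l%:num = a%:R / b%:R ->
           forall x : Rflat R, is_odd_power a b x (theta l x)]) /\
  (* (iii) *)
  (let O : set (Rflat R) := [set` `[-1 : R, 1 : R]] in
   [/\ compact O, is_subhyperring O
     & forall A : set (Rflat R), compact A -> is_subhyperring A -> A `<=` O]) /\
  (* (iv) *)
  ((forall x y : Rflat R, mdist x y = `|(x : R) - (y : R)|) /\
   (forall F : set_system (Rflat R), ProperFilter F -> cauchy F -> cvg F)).
Proof.
split; [split|split; [|split; [|split]]].
- by move=> x; rewrite /hadd /= /smile eqxx orbT.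
- move=> n n_odd; have [l ln] := odd_posreals R n n_odd.
  rewrite (_ : (fun _ => _) = theta_fun l); first exact: theta_aut.
  by apply/funext => x; rewrite (theta_odd _ n).
- pose th l : Aut (Rflat R) := MkAut (theta_aut R l).
  have thM : {morph th : l m / (l * m)%g}.
    by move=> l m; apply: aut_inj => x; exact/esym/theta_theta.
  pose theta : {multiplicative posreals R -> Aut (Rflat R)} :=
    HB.pack th (isMultiplicative.Build _ _ th thM).
  exists theta; split=> // [|a b l a_odd b_odd lab x]; last first.
    exact: theta_odd_power.
  have [tau tauP] := choice (@aut_theta R).
  have thK f : th (tau f) = f by apply: aut_inj => x; exact/esym/tauP.
  exists tau => // l; apply: theta_inj => x.
  by rewrite -tauP.
- move=> O.
  have OE : O = [set x : R | `|x| <= 1].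
    by apply/seteqP; split=> x; rewrite /O /= in_itv /= ler_norml.
  split; first exact: segment_compact.
    by rewrite OE; exact: unit_ball_subhyperring.
  by move=> A Ac Ah x Ax; rewrite OE; exact: compact_subhyperring_le1 Ax.
- by [].
- exact: R_complete.
Qed.
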